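(* Let $\mathcal D\subset\Omega_m^k$ be a set of $n\ge1$ nodes and let $f=\sum_{\alpha\in\mathbb Z_m^k}b_\alpha z^\alpha$ be the polynomial representation of its indicator function over $\Omega_m^k$. Let $\lambda$ be a measure on $\mathbb C^k$ with finite moments. Let $S\subset S_m$ be a set of monomials such that the pair $(\mathcal D,\operatorname{Span}_{\mathbb C}(S))$ is correct, and let $$w_S=\left(X_{\mathcal D,S}^t\right)^{-1}\left[\int_{\mathbb C^k}s\,d\lambda\right]_{s\in S},\qquad X_{\mathcal D,S}=[s(d)]_{d\in\mathcal D,\,s\in S}.$$ If $w_S=\frac1n1_n$, then the set $$A=\left\{z^\alpha\ :\ \alpha\in\mathbb Z_{\ge0}^k,\ \int_{\mathbb C^k}z^\alpha\,d\lambda=\frac{m^k}{n}\,b_{\overline\alpha}\right\}$$ is the precision basis for $(\mathcal D,w_S)$.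
   Context: Here $m\ge1$ is an integer and $\Omega_m\subset\mathbb C$ is the set of $m$-th roots of unity. For $\alpha\in\mathbb Z_{\ge0}^k$, $z^\alpha=z_1^{\alpha_1}\cdots z_k^{\alpha_k}$. $\mathbb Z_m$ is identified with $\{0,\dots,m-1\}$, and $S_m=\{z^\alpha:\alpha\in\mathbb Z_m^k\}=\{z^\alpha:0\le\alpha_i\le m-1\}$. For $\alpha\in\mathbb Z^k$, $\overline\alpha\in\mathbb Z_m^k$ denotes the vector of residues of $m-\alpha_i$ modulo $m$. The indicator function of $\mathcal D$ over $\Omega_m^k$ (equal to $1$ on $\mathcal D$ and $0$ on $\Omega_m^k\setminus\mathcal D$) is represented by the unique interpolating polynomial $f=\sum_{\alpha\in\mathbb Z_m^k}b_\alpha z^\alpha\in\operatorname{Span}_{\mathbb C}(S_m)$, with $b_\alpha=\frac1{m^k}\sum_{d\in\mathcal D}z^{\overline\alpha}(d)$. The pair $(\mathcal D,\mathcal P)$, with $\mathcal P$ a set of polynomials, is correct if for every $g:\mathbb C^k\to\mathbb C$ there is a unique $p\in\mathcal P$ with $p(d)=g(d)$ for all $d\in\mathcal D$; for $\mathcal P=\operatorname{Span}_{\mathbb C}(S)$ this is equivalent to $X_{\mathcal D,S}$ being square and non-singular. $1_n$ is the all-ones vector of length $n$. A cubature rule $(\mathcal D,w)$, $w=[w_d]_{d\in\mathcal D}$, approximates $\int g\,d\lambda$ by $\sum_{d\in\mathcal D}w_dg(d)$. The precision basis of $(\mathcal D,w)$ is the set $\mathcal B_{\mathcal D,w}$ of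 monomials $z^\alpha$, $\alpha\in\mathbb Z^k_{\ge0}$, such that $\int_{\mathbb C^k}z^\alpha\,d\lambda=\sum_{d\in\mathcal D}w_d\,z^\alpha(d)$ for all $z^\alpha\in\mathcal B_{\mathcal D,w}$ and $\int_{\mathbb C^k}z^\alpha\,d\lambda\ne\sum_{d\in\mathcal D}w_d\,z^\alpha(d)$ for all monomials $z^\alpha\notin\mathcal B_{\mathcal D,w}$. *)

(* Defs.v *)
(* MathComp, MathComp-Analysis, real-closed and multinomials. *)
From HB Require Import structures.
From mathcomp Require Import all_boot all_order all_algebra.
From mathcomp Require Import finmap complex.
From mathcomp Require Import all_classical all_reals all_analysis.
(* The notations of mpoly clash with those of MathComp-Analysis. *)
From mathcomp Require Import -(notations) mpoly.

Set Implicit Arguments.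
Unset Strict Implicit.
Unset Printing Implicit Defensive.

Import Order.TTheory GRing.Theory Num.Theory numFieldNormedType.Exports.

Local Open Scope ring_scope.
Local Open Scope complex_scope.
Local Open Scope classical_set_scope.

(* The sort of a numClosedFieldType carries the topology of the modulus. *)
Definition C (R : realType) : numClosedFieldType := R[i].

(* C^k with its Borel sigma-algebra. *)
Definition Cspace (R : realType) (k : nat) : measurableType _ :=
  g_sigma_algebraType (@open 'rV[C R]_k).

Section Polynomials.
Variables (R : realType) (k : nat).
Implicit Types (D : {fset 'rV[C R]_k}) (S : {fset multinom k}).

Definition peval (p : mpoly k (C R)) (z : 'rV[C R]_k) : C R :=
  meval (z ord0) p.

(* A monomial z^alpha is given by its exponent alpha : multinom k. *)
Definition mono (a : multinom k) : 'rV[C R]_k -> C R :=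
  peval (mpolyX (C R) a).

Definition Span S : set (mpoly k (C R)) :=
  [set p | exists c : multinom k -> C R,
     p = \sum_(a <- S) c a *: mpolyX (C R) a].

Definition correct D (P : set (mpoly k (C R))) : Prop :=
  forall g : 'rV[C R]_k -> C R,
    exists! p, P p /\ {in D, forall d, peval p d = g d}.

Definition Omega (m : nat) : set 'rV[C R]_k :=
  [set z | forall i, m.-unity_root (z ord0 i)].

Definition Sm (m : nat) : {fset multinom k} :=
  [fset Multinom [tuple nat_of_ord (a i) | i < k]
    | a : {ffun 'I_k -> 'I_m} in {: {ffun 'I_k -> 'I_m}}]%fset.

Definition indicator_poly (m : nat) D (f : mpoly k (C R)) : Prop :=
  Span (Sm m) f /\ (forall z, Omega m z -> peval f z = (z \in D)%:R).

(* Residues of m - alpha_i modulo m, in {0, ..., m-1} when m > 0. *)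
Definition conj_exp (m : nat) (a : multinom k) : multinom k :=
  Multinom [tuple `|((m%:Z - (a i)%:Z) %% m%:Z)%Z|%N | i < k].

(* The vectors and matrices indexed by a finite set follow the order of its
   canonical enumeration. *)
Definition Xmx D S : 'M[C R]_(#|` D|, #|` S|) :=
  \matrix_(i, j) mono (tnth (in_tuple S) j) (tnth (in_tuple D) i).

End Polynomials.

Section Cubature.
Variables (R : realType) (k : nat).
Implicit Types (D : {fset 'rV[C R]_k}) (S : {fset multinom k}).
Variable lam : {measure set (Cspace R k) -> \bar R}.

Definition cintegral (g : Cspace R k -> C R) : C R :=
  (Rintegral lam setT (fun z => complex.Re (g z)))
  +i* (Rintegral lam setT (fun z => complex.Im (g z))).

Definition cintegrable (g : Cspace R k -> C R) : Prop :=
  lam.-integrable setT (fun z => (complex.Re (g z))%:E) /\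
  lam.-integrable setT (fun z => (complex.Im (g z))%:E).

Definition finite_moments : Prop :=
  forall a : multinom k, cintegrable (mono (R := R) a).

Definition moment (a : multinom k) : C R := cintegral (mono (R := R) a).

Definition cubature D (w : 'cV[C R]_(#|` D|)) (g : 'rV[C R]_k -> C R) : C R :=
  \sum_(i < #|` D|) w i ord0 * g (tnth (in_tuple D) i).

Definition precision_basis D (w : 'cV[C R]_(#|` D|)) (B : set (multinom k)) :
    Prop :=
  (forall a, B a -> moment a = cubature w (mono a)) /\
  (forall a, ~ B a -> moment a <> cubature w (mono a)).

End Cubature.

Section CorrectSquare.
Variables (R : realType) (k : nat).
Variables (D : {fset 'rV[C R]_k}) (S : {fset multinom k}).
Hypothesis corr : correct D (Span S).

Let comb (c : 'cV[C R]_(#|` S|)) : mpoly k (C R) :=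
  \sum_(j < #|` S|) c j ord0 *: mpolyX (C R) (tnth (in_tuple S) j).

Let comb_span c : Span S (comb c).
Proof.
exists (fun a => if [pick j | tnth (in_tuple S) j == a] is Some j
                 then c j ord0 else 0).
rewrite (big_tnth _ _ S); apply: eq_bigr => j _; congr (_ *: _).
case: pickP => [j' /eqP e|/(_ j)]; last by rewrite eqxx.
have /tuple_uniqP inj : uniq (in_tuple S) by exact: fset_uniq.
by rewrite (inj _ _ e).
Qed.

Let span_comb p : Span S p -> exists c, p = comb c.
Proof.
case=> c ->; exists (\col_j c (tnth (in_tuple S) j)).
by rewrite (big_tnth _ _ S); apply: eq_bigr => j _; rewrite mxE.
Qed.

Let peval_comb c i : peval (comb c) (tnth (in_tuple D) i) = (Xmx D S *m c) i ord0.
Proof.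
rewrite /peval /comb raddf_sum mxE; apply: eq_bigr => j _ /=.
by rewrite mevalZ mxE mulrC.
Qed.

Let comb_inj : injective comb.
Proof.
move=> c c' e; apply/matrixP => j j0; rewrite (ord1 j0).
have /tuple_uniqP inj : uniq (in_tuple S) by exact: fset_uniq.
have H u : mcoeff (tnth (in_tuple S) j) (comb u) = u j ord0.
  rewrite /comb raddf_sum (bigD1 j) //= mcoeffZ mcoeffX eqxx mulr1.
  rewrite big1 ?addr0 // => l lj.
  rewrite mcoeffZ mcoeffX; case: eqP => [/inj E|_]; last by rewrite mulr0.
  by rewrite E eqxx in lj.
by rewrite -!H e.
Qed.

Lemma correct_card : #|` S| = #|` D|.
Proof.
apply/eqP; rewrite eqn_leq; apply/andP; split.
  suff /eqP <- : row_free (Xmx D S)^T by exact: rank_leq_col.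
  rewrite -kermx_eq0; apply/eqP/row_matrixP => r.
  set u := row r _; have u0 : Xmx D S *m u^T = 0.
    apply: trmx_inj; rewrite trmx_mul trmxK trmx0.
    by apply/sub_kermxP; exact: row_sub.
  have [p [_ uniq_p]] := corr (fun=> 0).
  have vanish c : Xmx D S *m c = 0 -> p = comb c.
    move=> c0; apply: uniq_p; split; first exact: comb_span.
    move=> d /(@tnthP _ _ (in_tuple D)) [i ->].
    by rewrite peval_comb c0 mxE.
  have /comb_inj e : comb u^T = comb 0 by rewrite -!vanish // mulmx0.
  by rewrite row0; apply: trmx_inj; rewrite e trmx0.
pose P j c := Xmx D S *m c = (delta_mx j ord0 : 'cV[C R]_(#|` D|)).
have exc j : exists c, P j c.
  have [p [[/span_comb [c ->] pd] _]] :=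
    corr (fun d => (d == tnth (in_tuple D) j)%:R).
  exists c; apply/matrixP => i i0; rewrite (ord1 i0) -peval_comb pd; last first.
    exact: (mem_tnth i (in_tuple D)).
  have /tuple_uniqP inj : uniq (in_tuple D) by exact: fset_uniq.
  by rewrite mxE eqxx andbT (inj_eq inj).
have [F FP] := choice exc.
pose Y := \matrix_(i < #|` S|, j < #|` D|) F j i ord0.
have XY : Xmx D S *m Y = 1%:M.
  apply/matrixP => i j; have /matrixP/(_ i ord0) := FP j.
  rewrite !mxE eqxx andbT => <-.
  by apply: eq_bigr => l _; rewrite !mxE.
rewrite -[leqLHS](mxrank1 (C R)) -XY.
by apply: leq_trans (mxrankM_maxl _ _) _; exact: rank_leq_col.
Qed.

End CorrectSquare.

(* w_S = (X^t)^-1 [moment s]_(s in S); the dimension cast along |S| = |D| makes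
   X a square matrix. *)
Definition weights (R : realType) (k : nat)
    (lam : {measure set (Cspace R k) -> \bar R})
    (D : {fset 'rV[C R]_k}) (S : {fset multinom k})
    (e : #|` S| = #|` D|) : 'cV[C R]_(#|` D|) :=
  let X : 'M[C R]_(#|` D|) := castmx (erefl, e) (Xmx D S) in
  let v : 'cV[C R]_(#|` S|) := \col_j moment lam (tnth (in_tuple S) j) in
  invmx X^T *m castmx (e, erefl) v.

(* Main.v *)
Require Import Defs.
From HB Require Import structures.
From mathcomp Require Import all_boot all_order all_algebra.
From mathcomp Require Import finmap complex.
From mathcomp Require Import all_classical all_reals all_analysis.
From mathcomp Require Import -(notations) mpoly.
From mathcomp Require Import cyclic separable cyclotomic zify.

Set Implicit Arguments.
Unset Strict Implicit.
Unset Printing Implicit Defensive.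

Import Order.TTheory GRing.Theory Num.Theory numFieldNormedType.Exports.

Local Open Scope ring_scope.
Local Open Scope classical_set_scope.

(** Both sides of the claim are governed by one Fourier inversion on the finite
    group (Z/m)^k.  Since the indicator polynomial [f] is [1] on [D] and [0] on
    the rest of the grid of [m]-th roots of unity, the sum over [D] of a monomial
    [z^a] is the sum over the whole grid of [f * z^a].  Expanding [f] into
    monomials [z^b] with exponents below [m], orthogonality of characters
    ([sum_grid_mono]) kills every term except the one with [b + a] divisible by
    [m] in each coordinate, that is [b = conj_exp m a]
    ([dvdn_add_conj_exp]).  Hence, for every exponent [a], however large,
    [\sum_(d in D) d^a = m^k * f_(conj_exp m a)] ([sum_mono_indicator]).

    With all the weights equal to [1/n], the cubature value of [z^a] is therefore
    [(m^k / n) * f_(conj_exp m a)], so that the equation that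
    cuts out the claimed basis is literally the equation saying that the cubature rule is exact at [z^a]. *)

(** In characteristic [0] the polynomial [X^m - 1] is separable, so it has [m]
    distinct roots in [F]; a finite group of units of a field is cyclic. *)
Lemma num_closed_prim_root_exists (F : numClosedFieldType) (m : nat) :
  (0 < m)%N -> exists w : F, m.-primitive_root w.
Proof.
move=> m_gt0; have [r] := closed_field_poly_normal ('X^m - 1 : {poly F}).
rewrite (monicP (monicXnsubC 1 m_gt0)) scale1r => Dp.
have sz_r : size r = m.
  by apply: succn_inj; rewrite -(size_prod_XsubC r id) -Dp size_XnsubC.
have r_roots : all m.-unity_root r.
  by apply/allP => z; rewrite unity_rootE -subr_eq0 -root_prod_XsubC -Dp
    rootE !hornerE.
have r_uniq : uniq r.
  rewrite -separable_prod_XsubC -Dp.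
  by apply: separable_Xn_sub_1; rewrite pnatr_eq0 -lt0n.
have /hasP[w _ w_prim] : has m.-primitive_root r.
  by rewrite has_prim_root // sz_r.
by exists w.
Qed.

(** Orthogonality of characters of the cyclic group of order [m]: a geometric
    sum of ratio [w ^+ e], which vanishes unless the ratio is [1]. *)
Lemma sum_prim_root_expr (F : fieldType) (m : nat) (w : F) (e : nat) :
  m.-primitive_root w ->
  \sum_(j < m) (w ^+ j) ^+ e = (m * (m %| e))%N%:R.
Proof.
move=> w_prim; under eq_bigr => j _ do rewrite -exprM mulnC exprM.
rewrite (prim_order_dvd w_prim); case: (eqVneq (w ^+ e) 1) => [->|we_neq1].
  under eq_bigr => j _ do rewrite expr1n.
  by rewrite sumr_const card_ord muln1.
rewrite muln0; apply/eqP.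
have : (w ^+ e - 1) * (\sum_(j < m) (w ^+ e) ^+ j) == 0.
  by rewrite -subrX1 -exprM mulnC exprM (prim_expr_order w_prim) expr1n subrr.
by rewrite mulf_eq0 subr_eq0 (negbTE we_neq1).
Qed.

Section Grid.
Variables (R : realType) (m k : nat) (w : C R).
Hypothesis w_prim : m.-primitive_root w.

(** Exponents of [w] as coordinates on Omega_m^k, so that a sum over the grid is
    a sum over a finite type and factors through the coordinates. *)
Definition grid_point (x : {ffun 'I_k -> 'I_m}) : 'rV[C R]_k :=
  \row_i w ^+ x i.

Lemma grid_point_inj : injective grid_point.
Proof.
move=> x y /rowP exy; apply/ffunP => i; apply/val_inj/eqP.
have /eqP := exy i; rewrite !mxE (eq_prim_root_expr w_prim).
by rewrite !modn_small.
Qed.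

Lemma Omega_grid_point x : Omega m (grid_point x).
Proof.
move=> i; rewrite mxE unity_rootE -exprM mulnC exprM.
by rewrite (prim_expr_order w_prim) expr1n.
Qed.

Lemma grid_point_surj z : Omega m z -> exists x, z = grid_point x.
Proof.
move=> z_unity.
have log i : {j : 'I_m | z ord0 i = w ^+ j}.
  by apply: (prim_rootP w_prim); apply/eqP; rewrite -unity_rootE.
exists [ffun i => sval (log i)]; apply/rowP => i.
by rewrite mxE ffunE; case: (log i).
Qed.

(** Summing over the grid against the indicator of [D] is how the values of the
    interpolating polynomial enter a sum over the nodes. *)
Lemma sum_grid_indicator (D : {fset 'rV[C R]_k}) (g : 'rV[C R]_k -> C R) :
  [set` D] `<=` Omega m ->
  \sum_x (grid_point x \in D)%:R * g (grid_point x) = \sum_(d <- D) g d.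
Proof.
move=> subD.
under eq_bigr => x _ do rewrite mulr_natl mulrb.
rewrite -big_mkcond -(big_map grid_point (mem D) g) /= -big_filter.
apply: perm_big; apply: uniq_perm.
- rewrite filter_uniq // map_inj_uniq ?index_enum_uniq //.
  exact: grid_point_inj.
- exact: fset_uniq.
move=> d; rewrite mem_filter; apply: andb_idr => dD.
have [x ->] := grid_point_surj (subD _ dD).
by rewrite map_f ?mem_index_enum.
Qed.

Lemma mono_grid_point a x : mono a (grid_point x) = \prod_i (w ^+ x i) ^+ a i.
Proof. by rewrite /mono /peval mevalX; apply: eq_bigr => i _; rewrite mxE. Qed.

(** Orthogonality of characters of (Z/m)^k: the sum is the product over the
    coordinates of the one-dimensional sums. *)
Lemma sum_grid_mono a :
  \sum_x mono a (grid_point x) = (m ^ k * [forall i, (m %| a i)%N])%N%:R.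
Proof.
under eq_bigr => x _ do rewrite mono_grid_point.
rewrite -(bigA_distr_bigA (fun i (j : 'I_m) => (w ^+ j) ^+ a i)).
under eq_bigr => i _ do rewrite (sum_prim_root_expr _ w_prim).
rewrite -natr_prod big_split prod_nat_const card_ord; congr (_ * _)%N%:R.
case: forallP => [dvd_a|ndvd_a]; first by rewrite big1 // => i _; rewrite dvd_a.
case: (pickP (fun i => ~~ (m %| a i)%N)) => [i nd|all_d].
  by rewrite (bigD1 i) //= (negbTE nd) mul0n.
by case: ndvd_a => i; exact: negbFE (all_d i).
Qed.

End Grid.

Lemma monoD (R : realType) k (a b : multinom k) (z : 'rV[C R]_k) :
  mono (mnm_add a b) z = mono a z * mono b z.
Proof. by rewrite /mono /peval mpolyXD mevalM. Qed.

(** In each coordinate the residue of [m - a i] is the only integer in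
    [0, ..., m - 1] whose sum with [a i] is divisible by [m]. *)
Lemma dvdn_add_conj_exp (m k : nat) (a b : multinom k) :
  (0 < m)%N -> b \in Sm k m ->
  [forall i, (m %| mnm_add b a i)%N] = (b == conj_exp m a).
Proof.
move=> m_gt0 /imfsetP[x _ ->].
set b' := Multinom _.
have b_lt i : (b' i < m)%N by rewrite multinomE tnth_mktuple.
(* The integer m - a i may be negative; m * (a i).+1 - a i is a natural number
   with the same residue. *)
have a_le i : (a i <= m * (a i).+1)%N.
  by apply: leq_trans (leqnSn _) _; exact: leq_pmull.
have conjE i : conj_exp m a i = ((m * (a i).+1 - a i) %% m)%N.
  rewrite multinomE tnth_mktuple.
  have -> : m%:Z - (a i)%:Z = (- (a i)%:Z) * m%:Z + (m * (a i).+1 - a i)%N%:Z.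
    by rewrite -subzn //; lia.
  by rewrite modzMDl modz_nat.
apply/forallP/eqP => [dvd_ab|-> i]; last first.
  by rewrite mnmDE conjE /dvdn modnDml subnK ?modnMr.
apply/mnmP => i; rewrite conjE.
rewrite -[LHS](modn_small (b_lt i)); apply/eqP.
rewrite -(eqn_modDr (a i)) subnK // modnMr.
by have := dvd_ab i; rewrite mnmDE.
Qed.

(** The Fourier inversion formula for the coefficients of the indicator
    polynomial; reducing the exponent modulo [m] loses nothing on [D], which is
    why it holds for every [a]. *)
Lemma sum_mono_indicator (R : realType) (m k : nat)
    (D : {fset 'rV[C R]_k}) (f : mpoly k (C R)) (a : multinom k) :
  (0 < m)%N -> [set` D] `<=` Omega m -> indicator_poly m D f ->
  \sum_(d <- D) mono a d = (m ^ k)%:R * mcoeff (conj_exp m a) f.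
Proof.
move=> m_gt0 subD [[c Df] f_ind].
have [w w_prim] := num_closed_prim_root_exists (C R) m_gt0.
rewrite -(sum_grid_indicator w_prim _ subD).
have expand (x : {ffun 'I_k -> 'I_m}) :
    (grid_point w x \in D)%:R * mono a (grid_point w x) =
    \sum_(b <- Sm k m) c b * mono (mnm_add b a) (grid_point w x).
  rewrite -(f_ind _ (Omega_grid_point w_prim x)) Df /peval raddf_sum mulr_suml.
  by apply: eq_bigr => b _; rewrite /= mevalZ -mulrA monoD.
under eq_bigr => x _ do rewrite expand.
rewrite exchange_big Df raddf_sum mulr_sumr big_seq [RHS]big_seq /=.
apply: eq_bigr => b Sm_b.
rewrite -mulr_sumr (sum_grid_mono w_prim) dvdn_add_conj_exp //.
by rewrite mcoeffZ mcoeffX natrM mulrCA.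
Qed.

Lemma cubature_const (R : realType) (k : nat) (D : {fset 'rV[C R]_k}) (t : C R) g :
  cubature (const_mx t : 'cV_(#|` D|)) g = t * \sum_(d <- D) g d.
Proof.
rewrite /cubature (big_tnth _ _ D) mulr_sumr.
by apply: eq_bigr => i _; rewrite mxE.
Qed.

Theorem theorem2 (R : realType) (m k n : nat) (m_gt0 : (0 < m)%N)
  (D : {fset 'rV[C R]_k}) (subD : [set` D] `<=` Omega m)
  (cardD : #|` D| = n) (n_gt0 : (0 < n)%N)
  (f : mpoly k (C R)) (f_ind : indicator_poly m D f)
  (lam : {measure set (Cspace R k) -> \bar R}) (lam_fin : finite_moments lam)
  (S : {fset multinom k}) (subS : (S `<=` Sm k m)%fset)
  (corr : correct D (Span S)) :
  let w := weights lam (correct_card corr) in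
  w = const_mx (n%:R^-1) ->
  precision_basis lam w
    [set a : multinom k |
       moment lam a = (m ^ k)%:R / n%:R * mcoeff (conj_exp m a) f].
Proof.
move=> w ->.
have cubE a : cubature (const_mx (n%:R^-1) : 'cV_(#|` D|)) (mono a) =
    (m ^ k)%:R / n%:R * mcoeff (conj_exp m a) f.
  rewrite cubature_const (sum_mono_indicator _ m_gt0 subD f_ind).
  by rewrite mulrA [_^-1 * _]mulrC.
by split=> a; rewrite cubE.
Qed.
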